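(* Let $R$ be a ring with identity, let $M$ be an $R$-module, let $n<m$ be non-negative integers, and let $$F_m\xrightarrow{\partial_m}F_{m-1}\xrightarrow{\partial_{m-1}}\cdots\to F_1\xrightarrow{\partial_1}F_0\to M\to 0$$ and $$G_n\xrightarrow{\partial_n'}G_{n-1}\xrightarrow{\partial_{n-1}'}\cdots\to G_1\xrightarrow{\partial_1'}G_0\to M\to 0$$ be exact sequences over $R$ with all $F_i$, $G_i$ finitely generated free modules. Then there exists an exact sequence over $R$ $$F_m\xrightarrow{\partial_m}F_{m-1}\xrightarrow{\partial_{m-1}}\cdots\xrightarrow{\partial_{n+3}}F_{n+2}\to SF\to G_n\xrightarrow{\partial_n'}\cdots\to G_1\xrightarrow{\partial_1'}G_0\to M\to 0,$$ with $SF$ finitely generated and stably free (in degree $n+1$), such that the complex $F_m\to\cdots\to F_{n+2}\to SF\to G_n\to\cdots\to G_0$ is chain homotopy equivalent to the complex $F_m\xrightarrow{\partial_m}F_{m-1}\to\cdots\to F_1\xrightarrow{\partial_1}F_0$.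
   Context: Modules are right $R$-modules and maps are $R$-linear. A module $S$ is (finitely generated) stably free if $S\oplus R^a\cong R^b$ for some integers $a,b\ge 0$. The module $M$ is not part of the complexes being compared. If $m=n+1$, the new sequence begins $SF\to G_n\to\cdots$. *)

(* Defs.v *)
From HB Require Import structures.
From mathcomp Require Import all_boot all_order all_algebra.

Set Implicit Arguments.
Unset Strict Implicit.
Unset Printing Implicit Defensive.

Import GRing.Theory.
Local Open Scope ring_scope.

(* A right R-module is a left module over the converse ring: [r *: x] in
   [rmodType R] stands for x r.  Rings are [pzRingType]s, so that the zero ring
   is allowed. *)
Notation rmodType R := (lmodType R^c).

Definition isomorphic (R : pzRingType) (U V : rmodType R) : Prop :=
  exists f : {linear U -> V}, bijective f.

Definition fg_free (R : pzRingType) (V : rmodType R) : Prop :=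
  exists a : nat, isomorphic V 'rV[R^c]_a.

Definition stably_free (R : pzRingType) (S : rmodType R) : Prop :=
  exists a b : nat, isomorphic (S * 'rV[R^c]_a)%type 'rV[R^c]_b.

(* [bd C i] is the boundary map usually written d_(i+1) : C_(i+1) -> C_i. *)
Record mod_seq (R : pzRingType) := ModSeq {
  term :> nat -> rmodType R;
  bd : forall i, {linear term i.+1 -> term i}
}.
Arguments bd {R} C i : rename.

Definition is_complex (R : pzRingType) (C : mod_seq R) : Prop :=
  forall i (x : C i.+2), bd C i (bd C i.+1 x) = 0.

Definition exact_at (R : pzRingType) (U V W : rmodType R)
    (f : {linear U -> V}) (g : {linear V -> W}) : Prop :=
  forall y, g y = 0 <-> exists x, f x = y.

(* The finite sequence C_m -> ... -> C_0 -> M -> 0 is exact.  It is encoded as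
   an infinite sequence vanishing in degrees > m; nothing is required at the
   leftmost term C_m, so when m = 0 only surjectivity of [eps] is. *)
Definition exact_seq (R : pzRingType) (m : nat) (C : mod_seq R)
    (M : rmodType R) (eps : {linear C 0%N -> M}) : Prop :=
  [/\ forall i, (m < i)%N -> forall x : C i, x = 0,
      forall y, exists x, eps x = y,
      (0 < m)%N -> exact_at (bd C 0) eps
    & forall i, (i.+1 < m)%N -> exact_at (bd C i.+1) (bd C i)].

Definition chain_map (R : pzRingType) (C D : mod_seq R)
    (f : forall i, {linear C i -> D i}) : Prop :=
  forall i (x : C i.+1), f i (bd C i x) = bd D i (f i.+1 x).

Definition chain_homotopic (R : pzRingType) (C D : mod_seq R)
    (f g : forall i, C i -> D i) : Prop :=
  exists h : forall i, {linear C i -> D i.+1},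
    (forall x, f 0%N x - g 0%N x = bd D 0 (h 0%N x)) /\
    (forall i x, f i.+1 x - g i.+1 x = bd D i.+1 (h i.+1 x) + h i (bd C i x)).

Definition chain_homotopy_equivalent (R : pzRingType) (C D : mod_seq R) : Prop :=
  [/\ is_complex C, is_complex D &
    exists (f : forall i, {linear C i -> D i})
           (g : forall i, {linear D i -> C i}),
      [/\ chain_map f, chain_map g,
          chain_homotopic (fun i => g i \o f i) (fun i => @idfun (C i))
        & chain_homotopic (fun i => f i \o g i) (fun i => @idfun (D i))]].

Definition shift_seq (R : pzRingType) (C : mod_seq R) : mod_seq R :=
  ModSeq (fun i => bd C i.+1).

(* The spliced sequence ... -> F_(n+3) -> F_(n+2) -> S -> G_n -> ... -> G_0.
   The recursion removes degree 0 from F and G simultaneously; compared with a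
   case analysis on [i <= n] this avoids transporting the maps along equalities
   of modules. *)
Fixpoint splice_term (R : pzRingType) (F G : mod_seq R) (S : rmodType R)
    (n i : nat) {struct i} : rmodType R :=
  match i with
  | 0 => G 0%N
  | i'.+1 => match n with
    | 0 => match i' with 0 => S | i''.+1 => F i''.+2 end
    | n'.+1 => splice_term (shift_seq F) (shift_seq G) S n' i'
    end
  end.

Fixpoint splice_bd (R : pzRingType) (F G : mod_seq R) (S : rmodType R) (n : nat)
    {struct n} :
    {linear F n.+2 -> S} -> {linear S -> G n} ->
    forall i, {linear splice_term F G S n i.+1 -> splice_term F G S n i} :=
  match n with
  | 0 => fun alpha beta i =>
      match i with
      | 0 => beta
      | 1 => alpha
      | i'.+2 => bd F i'.+2
      end
  | n'.+1 => fun alpha beta i =>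
      match i with
      | 0 => bd G 0
      | i'.+1 => @splice_bd R (shift_seq F) (shift_seq G) S n' alpha beta i'
      end
  end.

Definition splice (R : pzRingType) (F G : mod_seq R) (S : rmodType R) (n : nat)
    (alpha : {linear F n.+2 -> S}) (beta : {linear S -> G n}) : mod_seq R :=
  ModSeq (splice_bd alpha beta).

Lemma splice_low (R : pzRingType) (F G : mod_seq R) S n i :
  (i <= n)%N -> splice_term F G S n i = G i.
Proof.
by elim: i n F G => [|i IH] [|n] F G //= /(IH n (shift_seq F) (shift_seq G)).
Qed.

Lemma splice_mid (R : pzRingType) (F G : mod_seq R) S n :
  splice_term F G S n n.+1 = S.
Proof. by elim: n F G => [|n IH] F G //=; apply: IH. Qed.

Lemma splice_high (R : pzRingType) (F G : mod_seq R) S n i :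
  (n.+1 < i)%N -> splice_term F G S n i = F i.
Proof.
elim: n i F G => [|n IH] [|i] F G //=; first by case: i.
by move=> /(IH i (shift_seq F) (shift_seq G)).
Qed.

(* Main.v *)
Require Import Defs.
From HB Require Import structures.
From mathcomp Require Import all_boot all_order all_algebra.

Set Implicit Arguments.
Unset Strict Implicit.
Unset Printing Implicit Defensive.

Import GRing.Theory.
Local Open Scope ring_scope.

(** The modules of F are exchanged for those of G one degree at a time, from
    the bottom upwards.

    Suppose that T -> Q -> P -> A and N -> A are given, that P and N are
    projective, and that the maps e : P -> A and eta : N -> A have the same
    image.  Projectivity gives lifts u : P -> N of e and v : N -> P of eta.
    Let S be the pullback of p : Q -> P and v.  Then S -> N has image
    ker eta, the map T -> Q induces T -> S, and T -> S -> N -> A is exact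
    where T -> Q -> P -> A is.  As in Schanuel's lemma, S is the kernel of the
    split surjection (q, y) |-> p q - v y from Q + N onto P, so S + P is
    isomorphic to Q + N and S is stably free.  The projection S -> Q and v
    form a chain map, and it is a homotopy equivalence: since v u - 1 sends P
    into ker e = im p, it factors as p k, and both u, v and the two required
    homotopies extend over Q and S by explicit formulas in k.  All of this is
    the content of [exchange].

    The sequence T -> S has the same tail as F, and S -> N has the same image
    as the next map G_1 -> G_0 = N, namely ker eta.  So the exchange applies
    again with A replaced by G_0, the only change being that the bottom module
    P = S is stably free and no longer free.  After n + 1 exchanges the
    stably free module sits in degree n + 1 ([splice_exchange]).

    For the homotopy equivalences to be reassembled, each of them has to
    commute with the maps to A ([aug_equiv]): an equivalence over G_0 extends
    by the identity of G_0 to the longer complexes ([aug_equiv_cons]). *)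

(** * Linear maps and kernels *)

Lemma linear_ext (R : pzRingType) (U V : rmodType R) (f : U -> V) :
  linear f -> exists g : {linear U -> V}, g =1 f.
Proof.
move=> flin.
pose g : {linear U -> V} :=
  HB.pack_for {linear U -> V} f (GRing.isLinear.Build R^c U V *:%R f flin).
by exists g.
Qed.

Definition kernel (R : pzRingType) (U V : rmodType R) (phi : {linear U -> V}) :
  {pred U} := fun x => phi x == 0.

Lemma kernel_submod (R : pzRingType) (U V : rmodType R)
  (phi : {linear U -> V}) : submod_closed (kernel phi).
Proof.
split=> [|a x y]; rewrite !unfold_in ?linear0 // => /eqP x0 /eqP y0.
by rewrite linearP x0 y0 scaler0 addr0.
Qed.

HB.instance Definition _ (R : pzRingType) (U V : rmodType R)
  (phi : {linear U -> V}) :=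
  GRing.isSubmodClosed.Build R^c U (kernel phi) (kernel_submod phi).

Definition kernel_type (R : pzRingType) (U V : rmodType R)
  (phi : {linear U -> V}) := {x : U | x \in kernel phi}.
HB.instance Definition _ (R : pzRingType) (U V : rmodType R)
  (phi : {linear U -> V}) := SubChoice.on (kernel_type phi).
HB.instance Definition _ (R : pzRingType) (U V : rmodType R)
  (phi : {linear U -> V}) :=
  [SubChoice_isSubLmodule of (kernel_type phi) by <:].

Lemma kernel_eq0 (R : pzRingType) (U V : rmodType R) (phi : {linear U -> V})
  (s : kernel_type phi) : phi (val s) = 0.
Proof. by apply/eqP; have := valP s. Qed.

Lemma kernel_mem (R : pzRingType) (U V : rmodType R) (phi : {linear U -> V})
  (x : U) : phi x = 0 -> exists s : kernel_type phi, val s = x.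
Proof.
move=> x0; have xker : x \in kernel phi by rewrite unfold_in x0.
by exists (Sub x xker); rewrite SubK.
Qed.

Lemma kernel_corestrict (R : pzRingType) (T U V : rmodType R)
    (phi : {linear U -> V}) (f : {linear T -> U}) :
  (forall t, phi (f t) = 0) ->
  exists g : {linear T -> kernel_type phi}, forall t, val (g t) = f t.
Proof.
move=> phif0.
have fker t : f t \in kernel phi by rewrite unfold_in phif0.
have [|g gE] := @linear_ext R T (kernel_type phi) (fun t => Sub (f t) (fker t)).
  by move=> a x y; apply: val_inj; rewrite [RHS]linearP !SubK linearP.
by exists g => t; rewrite gE SubK.
Qed.

(** * Isomorphisms and stably free modules *)

Lemma isomorphic_refl (R : pzRingType) (U : rmodType R) : isomorphic U U.
Proof. by exists idfun; exists idfun. Qed.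

Lemma isomorphic_sym (R : pzRingType) (U V : rmodType R) :
  isomorphic U V -> isomorphic V U.
Proof.
case=> f [g fK gK]; have [h hE] := linear_ext (can2_linear fK gK).
by exists h; exists f => x; rewrite hE.
Qed.

Lemma isomorphic_trans (R : pzRingType) (U V W : rmodType R) :
  isomorphic U V -> isomorphic V W -> isomorphic U W.
Proof. by case=> f fb [g gb]; exists (g \o f); apply: bij_comp. Qed.

Lemma can_isomorphic (R : pzRingType) (U V : rmodType R) (f : U -> V)
  (g : V -> U) : linear f -> cancel f g -> cancel g f -> isomorphic U V.
Proof.
move=> /linear_ext[h hE] fK gK; exists h; exists g => x; rewrite hE //.
Qed.

Lemma isomorphic_prod (R : pzRingType) (U U' V V' : rmodType R) :
  isomorphic U U' -> isomorphic V V' ->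
  isomorphic (U * V)%type (U' * V')%type.
Proof.
case=> f [f' fK f'K] [g [g' gK g'K]].
apply: (@can_isomorphic _ _ _ (fun x => (f x.1, g x.2))
                        (fun x => (f' x.1, g' x.2))).
- by move=> a x y /=; rewrite !linearP.
- by case=> x y /=; rewrite fK gK.
- by case=> x y /=; rewrite f'K g'K.
Qed.

Lemma isomorphic_prodA (R : pzRingType) (U V W : rmodType R) :
  isomorphic (U * (V * W))%type ((U * V) * W)%type.
Proof.
by apply: (@can_isomorphic _ _ _ (fun x => ((x.1, x.2.1), x.2.2))
             (fun x => (x.1.1, (x.1.2, x.2)))) => [a x y|[x [y z]]|[[x y] z]].
Qed.

Lemma split_kernel (R : pzRingType) (U V : rmodType R)
    (phi : {linear U -> V}) (s : {linear V -> U}) :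
  cancel s phi -> isomorphic (kernel_type phi * V)%type U.
Proof.
move=> sK; have [|c cE] := @kernel_corestrict _ _ _ _ phi (idfun \- (s \o phi)).
  by move=> x; rewrite /= linearB /= sK subrr.
apply: (@can_isomorphic _ _ _ (fun y => val y.1 + s y.2)
          (fun x => (c x, phi x))) => [a x y | [y x] | x] /=.
- by rewrite !linearP scalerDr addrACA.
- have phix : phi (val y + s x) = x by rewrite linearD kernel_eq0 add0r sK.
  by congr pair => //; apply: val_inj; rewrite cE /= phix addrK.
- by rewrite cE /= subrK.
Qed.

Lemma fg_free_isomorphic (R : pzRingType) (U V : rmodType R) :
  isomorphic U V -> fg_free V -> fg_free U.
Proof. by move=> iUV [a Va]; exists a; apply: isomorphic_trans Va. Qed.

Lemma fg_free_prod (R : pzRingType) (U V : rmodType R) :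
  fg_free U -> fg_free V -> fg_free (U * V)%type.
Proof.
move=> [a Ua] [b Vb]; exists (a + b)%N.
apply: (isomorphic_trans (isomorphic_prod Ua Vb)).
apply: (@can_isomorphic _ _ _ (fun x => row_mx x.1 x.2)
          (fun x => (lsubmx x, rsubmx x))).
- by move=> c x y; rewrite scale_row_mx add_row_mx.
- by case=> x y; rewrite row_mxKl row_mxKr.
- by move=> x; rewrite hsubmxK.
Qed.

Lemma fg_free_row (R : pzRingType) n : @fg_free R 'rV[R^c]_n.
Proof. by exists n; apply: isomorphic_refl. Qed.

Lemma fg_free_stably_free (R : pzRingType) (U : rmodType R) :
  fg_free U -> stably_free U.
Proof.
by move=> freeU; exists 0%N; apply: fg_free_prod (fg_free_row R 0).
Qed.

(** With P + R^a isomorphic to R^b, the module S + R^b is isomorphic to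
    S + P + R^a, hence to U + R^a. *)
Lemma stably_free_cancel (R : pzRingType) (S P U : rmodType R) :
  isomorphic (S * P)%type U -> stably_free P -> fg_free U -> stably_free S.
Proof.
move=> SPU [a [b Pab]] freeU; exists b.
apply: fg_free_isomorphic (fg_free_prod freeU (fg_free_row R a)).
apply: (isomorphic_trans (V := (S * (P * 'rV[R^c]_a))%type)).
  by apply: isomorphic_prod (isomorphic_sym Pab); apply: isomorphic_refl.
apply: isomorphic_trans (isomorphic_prodA _ _ _) _.
by apply: isomorphic_prod SPU _; apply: isomorphic_refl.
Qed.

(** Projectivity, in a form that does not ask e to be surjective: it is
    enough that u takes its values in the image of e. *)
Definition has_lifting (R : pzRingType) (P : rmodType R) : Prop :=
  forall (U V : rmodType R) (e : {linear U -> V}) (u : {linear P -> V}),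
    (forall x, exists y, e y = u x) ->
    exists w : {linear P -> U}, forall x, e (w x) = u x.

Lemma row_space_lifting (R : pzRingType) n : has_lifting 'rV[R^c]_n.
Proof.
move=> U V e u eu.
have ex (i : 'I_n) : exists y, e y == u (delta_mx 0 i).
  by have [y <-] := eu (delta_mx 0 i); exists y.
have [|w wE] := @linear_ext R 'rV[R^c]_n U
    (fun x => \sum_i x 0 i *: xchoose (ex i)).
  move=> a x y; rewrite scaler_sumr -big_split /=; apply: eq_bigr => i _.
  by rewrite !mxE scalerDl scalerA.
exists w => x; rewrite wE linear_sum [in RHS](row_sum_delta x) linear_sum.
by apply: eq_bigr => i _; rewrite !linearZ (eqP (xchooseP (ex i))).
Qed.

Lemma stably_free_lifting (R : pzRingType) (P : rmodType R) :
  stably_free P -> has_lifting P.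
Proof.
case=> a [b [f [g fK gK]]] U V e u eu.
have [h hE] := linear_ext (can2_linear fK gK).
have [|w wE] := @row_space_lifting R b U V e (u \o (fst \o h)).
  by move=> x; apply: eu.
have [|j jE] := @linear_ext R P (P * 'rV[R^c]_a)%type (fun x => (x, 0)).
  by move=> c x y; congr pair; rewrite /= scaler0 addr0.
by exists (w \o (f \o j)) => x /=; rewrite wE /= hE fK jE.
Qed.

(** * Augmented homotopy equivalences *)

(** Chain homotopy equivalence over A.  The compatibility with the maps to A
    is what allows an equivalence of tails to be extended by one degree. *)
Definition aug_equiv (R : pzRingType) (A : rmodType R) (C D : mod_seq R)
    (eC : {linear C 0%N -> A}) (eD : {linear D 0%N -> A}) : Prop :=
  exists (f : forall i, {linear C i -> D i})
         (g : forall i, {linear D i -> C i}),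
    [/\ chain_map f /\ (forall x, eD (f 0%N x) = eC x),
        chain_map g /\ (forall x, eC (g 0%N x) = eD x),
        chain_homotopic (fun i => g i \o f i) (fun i => @idfun (C i))
      & chain_homotopic (fun i => f i \o g i) (fun i => @idfun (D i))].

Lemma chain_homotopic_refl (R : pzRingType) (C D : mod_seq R)
  (f : forall i, C i -> D i) : chain_homotopic f f.
Proof.
by exists (fun i => \0); split=> [x|i x]; rewrite subrr linear0 ?addr0.
Qed.

Lemma aug_equiv_refl (R : pzRingType) (A : rmodType R) (C : mod_seq R)
  (e : {linear C 0%N -> A}) : aug_equiv e e.
Proof.
by exists (fun i => idfun), (fun i => idfun); split=> //;
  apply: chain_homotopic_refl.
Qed.

(** If h and k are the two given homotopies, then h + g1 k f1 is one for the
    composites, because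
    g1 g2 f2 f1 - 1 = g1 (g2 f2 - 1) f1 + (g1 f1 - 1). *)
Lemma chain_homotopic_comp_id (R : pzRingType) (C D E : mod_seq R)
    (f1 : forall i, {linear C i -> D i}) (g1 : forall i, {linear D i -> C i})
    (f2 : forall i, {linear D i -> E i}) (g2 : forall i, {linear E i -> D i}) :
  chain_map f1 -> chain_map g1 ->
  chain_homotopic (fun i => g1 i \o f1 i) (fun i => @idfun (C i)) ->
  chain_homotopic (fun i => g2 i \o f2 i) (fun i => @idfun (D i)) ->
  chain_homotopic (fun i => (g1 i \o g2 i) \o (f2 i \o f1 i))
                  (fun i => @idfun (C i)).
Proof.
move=> f1C g1C [h [h0 hS]] [k [k0 kS]].
exists (fun i => (g1 i.+1 \o (k i \o f1 i)) \+ h i).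
have split_diff i x : (g1 i \o g2 i \o (f2 i \o f1 i)) x - idfun x =
    g1 i ((g2 i \o f2 i) (f1 i x) - idfun (f1 i x))
    + ((g1 i \o f1 i) x - idfun x).
  by rewrite linearB /= addrA subrK.
split=> [x|i x]; rewrite split_diff.
  by rewrite k0 h0 g1C /= linearD.
by rewrite kS hS linearD g1C /= linearD f1C addrACA.
Qed.

Lemma aug_equiv_trans (R : pzRingType) (A : rmodType R) (C D E : mod_seq R)
    (eC : {linear C 0%N -> A}) (eD : {linear D 0%N -> A})
    (eE : {linear E 0%N -> A}) :
  aug_equiv eC eD -> aug_equiv eD eE -> aug_equiv eC eE.
Proof.
move=> [f1 [g1 [[f1C f1e] [g1C g1e] h1 k1]]].
move=> [f2 [g2 [[f2C f2e] [g2C g2e] h2 k2]]].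
exists (fun i => f2 i \o f1 i), (fun i => g1 i \o g2 i); split.
- by split=> [i x|x] /=; rewrite ?f1C ?f2C ?f2e.
- by split=> [i x|x] /=; rewrite ?g2C ?g1C ?g1e.
- exact: chain_homotopic_comp_id.
- exact: chain_homotopic_comp_id.
Qed.

(** A definition of its own, so that the type of [cons_bd] mentions modules
    and not a match whose branches are coerced one by one. *)
Definition cons_term (R : pzRingType) (P : rmodType R) (C : mod_seq R)
    (i : nat) : rmodType R :=
  if i is j.+1 then C j else P.

Definition cons_bd (R : pzRingType) (P : rmodType R) (C : mod_seq R)
    (p : {linear C 0%N -> P}) (i : nat) :
    {linear cons_term P C i.+1 -> cons_term P C i} :=
  if i is j.+1 then bd C j else p.

Definition seq_cons (R : pzRingType) (P : rmodType R) (C : mod_seq R)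
    (p : {linear C 0%N -> P}) : mod_seq R :=
  ModSeq (cons_bd p).

(** The identity in degree 0 and the zero homotopy out of degree 0 extend the
    data of the tails; the commutation with the maps to C_0 makes the lowest
    square commute.  The left complex is arbitrary because the lemma has to
    apply to splices, which are not of the form [seq_cons]. *)
Lemma aug_equiv_cons (R : pzRingType) (A : rmodType R) (C D : mod_seq R)
    (e : {linear C 0%N -> A}) (p : {linear D 0%N -> C 0%N}) :
  aug_equiv (C := shift_seq C) (bd C 0) p ->
  aug_equiv e (e : {linear seq_cons p 0%N -> A}).
Proof.
move=> [f [g [[fC fe] [gC ge] [h [h0 hS]] [k [k0 kS]]]]].
exists (fun i => match i return {linear C i -> seq_cons p i} with
                 | 0 => idfun | j.+1 => f j end).
exists (fun i => match i return {linear seq_cons p i -> C i} with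
                 | 0 => idfun | j.+1 => g j end).
split.
- by split=> // -[|i] x /=; [rewrite fe | apply: fC].
- by split=> // -[|i] x /=; [rewrite ge | apply: gC].
- exists (fun i => match i return {linear C i -> C i.+1} with
                   | 0 => \0 | j.+1 => h j end).
  split=> [x|[|i] x] /=; rewrite ?subrr ?linear0 ?addr0 //; first exact: h0.
  exact: hS.
- exists (fun i => match i return {linear seq_cons p i -> seq_cons p i.+1} with
                   | 0 => \0 | j.+1 => k j end).
  split=> [x|[|i] x] /=; rewrite ?subrr ?linear0 ?addr0 //; first exact: k0.
  exact: kS.
Qed.

(** Both sides have the same modules and maps in each degree, but they are
    convertible only once the degree is a numeral or a successor. *)
Lemma aug_equiv_seq_cons (R : pzRingType) (A : rmodType R) (C : mod_seq R)
    (e : {linear C 0%N -> A}) :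
  aug_equiv e
    (e : {linear @seq_cons R (C 0%N) (shift_seq C) (bd C 0) 0%N -> A}).
Proof. exact: aug_equiv_cons (aug_equiv_refl _). Qed.

Lemma aug_equiv_sym (R : pzRingType) (A : rmodType R) (C D : mod_seq R)
    (eC : {linear C 0%N -> A}) (eD : {linear D 0%N -> A}) :
  aug_equiv eC eD -> aug_equiv eD eC.
Proof. by move=> [f [g []]]; exists g, f. Qed.

(** * Partial resolutions *)

(** Exactness as in [exact_seq], with the surjectivity of e left out: after an
    exchange the target is G_0, and only the image of e is under control. *)
Definition resolves (R : pzRingType) (A : rmodType R) (m : nat)
    (C : mod_seq R) (e : {linear C 0%N -> A}) : Prop :=
  [/\ forall i, (m < i)%N -> forall x : C i, x = 0,
      (0 < m)%N -> exact_at (bd C 0) e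
    & forall i, (i.+1 < m)%N -> exact_at (bd C i.+1) (bd C i)].

Lemma resolvesS (R : pzRingType) (A : rmodType R) (m : nat)
    (C : mod_seq R) (e : {linear C 0%N -> A}) :
  resolves m.+1 e <->
  exact_at (bd C 0) e /\ resolves (C := shift_seq C) m (bd C 0).
Proof.
split=> [[C0 Ce Cex]|[Ce [C0 C1 Cex]]].
- split; first exact: Ce.
  by split=> [i|m0|i im]; [apply: (C0 i.+1) | apply: (Cex 0%N)
    | apply: (Cex i.+1)].
- split=> //; first by case=> // i im; apply: (C0 i).
  by case=> [m0|i im]; [apply: C1 | apply: (Cex i)].
Qed.

Lemma resolves_cons (R : pzRingType) (A : rmodType R) (m : nat) (C : mod_seq R)
    (e : {linear C 0%N -> A}) :
  resolves m e <->
  resolves m (C := @seq_cons R (C 0%N) (shift_seq C) (bd C 0)) e.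
Proof.
split=> [] [C0 C1 Cex].
all: by split=> // [[|i]|[|i]]; [apply: (C0 0%N) | apply: (C0 i.+1)
  | apply: (Cex 0%N) | apply: (Cex i.+1)].
Qed.

Lemma resolves_complex (R : pzRingType) (A : rmodType R) (m : nat)
    (C : mod_seq R) (e : {linear C 0%N -> A}) : resolves m e -> is_complex C.
Proof.
case=> C0 _ Cex i x; have [im|mi] := ltnP i.+1 m.
  by apply/(Cex i im); exists x.
by rewrite (C0 i.+2 mi x) !linear0.
Qed.

(** * Exchanging the bottom module *)

(** One exchange: the bottom module P of T_1 -> T_0 -> P is replaced by N, and
    T_0 by the pullback S of p and v. *)
Lemma exchange (R : pzRingType) (A P N : rmodType R) (T : mod_seq R) (m : nat)
    (p : {linear T 0%N -> P})
    (e : {linear P -> A}) (eta : {linear N -> A}) :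
  resolves m.+1 (C := seq_cons p) e ->
  (forall a, (exists x, e x = a) <-> (exists y, eta y = a)) ->
  stably_free P -> fg_free (T 0%N) -> fg_free N ->
  exists (S : rmodType R) (alpha : {linear T 1%N -> S})
         (beta : {linear S -> N}),
    [/\ stably_free S,
        forall y, eta y = 0 <-> exists s, beta s = y,
        resolves m (C := @seq_cons R S (shift_seq T) alpha) beta
      & aug_equiv
          (C := seq_cons (C := @seq_cons R S (shift_seq T) alpha) beta) eta
          (D := seq_cons p) e].
Proof.
move=> resE im_eq sfP freeQ freeN.
have cxE := resolves_complex resE.
have /resolvesS[pe resT] := resE.
have liftP := stably_free_lifting sfP.
have liftN := stably_free_lifting (fg_free_stably_free freeN).
have [|u uE] := liftP _ _ eta e; first by move=> x; apply/im_eq; exists x.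
have [|v vE] := liftN _ _ e eta; first by move=> y; apply/im_eq; exists y.
(* v u - 1 takes its values in ker e = im p, so it factors through p. *)
have [|k kE] := liftP _ _ p ((v \o u) \- idfun).
  by move=> x; apply/pe; rewrite /= linearB /= vE uE subrr.
have ep q : e (p q) = 0 by apply/pe; exists q.
(* S is the kernel of phi, that is, the pullback of p and v. *)
pose phi : {linear (T 0%N * N)%type -> P} := (p \o fst) \- (v \o snd).
have phiE (s : kernel_type phi) : p (val s).1 = v (val s).2.
  by apply/eqP; rewrite -subr_eq0; apply/eqP; apply: (kernel_eq0 s).
have mkS (X : rmodType R) (a : {linear X -> T 0%N}) (b : {linear X -> N}) :
    (forall x, p (a x) = v (b x)) ->
    exists f : {linear X -> kernel_type phi}, forall x, val (f x) = (a x, b x).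
  move=> ab.
  have [|c cE] := @linear_ext R X (T 0%N * N)%type (fun x => (a x, b x)).
    by move=> r x y; rewrite !linearP.
  have [|f fE] := @kernel_corestrict _ _ _ _ phi c.
    by move=> x; rewrite /phi cE /= ab subrr.
  by exists f => x; rewrite fE cE.
have [|alpha alphaE] := mkS _ (bd T 0) \0.
  by move=> t; rewrite linear0; apply: (cxE 0%N t).
(* The component of the homotopy inverse in degree 1; the correction k p
   makes the pair lie in the pullback. *)
have [|f1 f1E] := mkS _ (idfun \+ (k \o p)) (u \o p).
  by move=> q; rewrite /= linearD kE /= addrC subrK.
(* A homotopy from u v to the identity of N. *)
have [|h0 h0E] := mkS _ (k \o v) ((u \o v) \- idfun).
  by move=> y; rewrite /= kE /= linearB.
pose beta : {linear kernel_type phi -> N} := snd \o val.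
exists (kernel_type phi), alpha, beta; split.
- apply: (stably_free_cancel _ sfP (fg_free_prod freeQ freeN)).
  (* A section of phi: p (- k x) - v (- u x) = - (v u - 1) x + v u x = x. *)
  have [|s sE] := @linear_ext R P (T 0%N * N)%type (fun x => (- k x, - u x)).
    by move=> a x y; rewrite !linearP.
  apply: (@split_kernel _ _ _ phi s) => x.
  by rewrite sE /phi /= !linearN kE /= opprB opprK subrK.
- move=> y; split=> [y0|[s <-]].
    have /pe[q qE] : e (v y) = 0 by rewrite vE.
    have [|s sE] := @kernel_mem _ _ _ phi (q, y).
      by rewrite /phi /= qE subrr.
    by exists s; rewrite /beta /= sE.
  by rewrite -vE /beta /= -phiE ep.
- have [T0 T1 Tex] := resT; split=> [[|i]// im|m0 s|[|i] im /=].
  + exact: (T0 i.+1 im).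
  + split=> [s0|[t <-]]; last by rewrite /beta /= alphaE.
    have /(T1 m0)[t tE] : p (val s).1 = 0 by rewrite phiE [_.2]s0 linear0.
    exists t; apply: val_inj; rewrite /= alphaE /= tE -[in LHS]s0.
    exact/esym/surjective_pairing.
  + move=> t; apply: iff_trans (Tex 0%N im t); split=> [t0|t0].
      by have := alphaE t; rewrite t0 => -[<-].
    by apply: val_inj; rewrite alphaE /= t0.
  + exact: (Tex i.+1).
- set C := @seq_cons R (kernel_type phi) (shift_seq T) alpha.
  set D := @seq_cons R N C beta; set E := seq_cons p.
  exists (fun i => match i return {linear D i -> E i} with
      | 0 => v | 1 => fst \o val | j.+2 => idfun end).
  exists (fun i => match i return {linear E i -> D i} with
      | 0 => u | 1 => f1 | j.+2 => idfun end).
  split.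
  + split=> // -[|[|i]] x //=; first by rewrite phiE.
    by rewrite alphaE.
  + split=> // -[|[|i]] x //=; first by rewrite /beta /= f1E.
    apply: val_inj; rewrite f1E alphaE /= (cxE 0%N x) !linear0 addr0 //.
  + exists (fun i => match i return {linear D i -> D i.+1} with
      | 0 => h0 | j.+1 => \0 end).
    split=> [x|[|i] x] /=; first by rewrite /beta /= h0E.
      apply: val_inj; rewrite linear0 add0r h0E.
      transitivity (val (f1 (val x).1) - val x); first exact: linearB.
      rewrite f1E /= phiE /=.
      by case: (sval x) => q y; congr pair; rewrite /= addrAC subrr add0r.
    by rewrite subrr linear0 addr0.
  + exists (fun i => match i return {linear E i -> E i.+1} with
      | 0 => k | j.+1 => \0 end).
    split=> [x|[|i] x] /=; first by rewrite kE.
      by rewrite linear0 add0r f1E /= addrAC subrr add0r.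
    by rewrite subrr linear0 addr0.
Qed.

(** The induction on n.  F enters only through its terms in degrees at least 1;
    its bottom module is replaced by P, because in the inductive step it is
    the stably free module of the previous exchange.  Keeping F as a parameter
    makes the maps of the two splices agree by conversion. *)
Lemma splice_exchange (R : pzRingType) (n m : nat) (A P : rmodType R)
    (F G : mod_seq R) (p : {linear F 1%N -> P})
    (e : {linear P -> A}) (eta : {linear G 0%N -> A}) :
  (n < m)%N ->
  resolves m (C := @seq_cons R P (shift_seq F) p) e ->
  resolves n eta ->
  (forall a, (exists x, e x = a) <-> (exists y, eta y = a)) ->
  stably_free P ->
  (forall i, (0 < i <= m)%N -> fg_free (F i)) ->
  (forall i, (i <= n)%N -> fg_free (G i)) ->
  exists (S : rmodType R) (alpha : {linear F n.+2 -> S})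
         (beta : {linear S -> G n}),
    [/\ stably_free S, resolves m (C := splice alpha beta) eta
      & aug_equiv (C := splice alpha beta) eta
          (D := @seq_cons R P (shift_seq F) p) e].
Proof.
elim: n m A P F G p e eta => [|n IH] [|m] A P F G p e eta // nm resF resG
  im_eq sfP freeF freeG.
all: have freeF1 : fg_free (shift_seq F 0%N) by exact: (freeF 1%N).
all: have [S [alpha [beta [sfS eta0 resS equivS]]]] :=
  exchange resF im_eq sfP freeF1 (freeG 0%N isT).
- exists S, alpha, beta; split=> //.
    apply/resolvesS; split; first exact: eta0.
    by apply/resolves_cons; apply: resS.
  apply: aug_equiv_trans equivS; apply: aug_equiv_cons.
  exact: aug_equiv_seq_cons.
- have /resolvesS[eta_ex resG'] := resG.
  have [||||S' [alpha' [beta' [sfS' res' equiv']]]] :=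
    IH m (G 0%N) S (shift_seq F) (shift_seq G) alpha beta (bd G 0) nm
      resS resG'.
  + by move=> y; apply: iff_trans (iff_sym (eta0 y)) (eta_ex y).
  + exact: sfS.
  + by move=> i /andP[_ im]; apply: (freeF i.+1).
  + by move=> i im; apply: (freeG i.+1).
  exists S', alpha', beta'; split=> //.
    apply/resolvesS; split; first exact: eta_ex.
    exact: res'.
  apply: aug_equiv_trans equivS; apply: aug_equiv_cons.
  exact: equiv'.
Qed.

Theorem theorem1p5p1 (R : pzRingType) (M : rmodType R) (n m : nat)
    (hnm : (n < m)%N)
    (F G : mod_seq R) (epsF : {linear F 0%N -> M}) (epsG : {linear G 0%N -> M})
    (exF : exact_seq m epsF) (exG : exact_seq n epsG)
    (freeF : forall i, (i <= m)%N -> fg_free (F i))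
    (freeG : forall i, (i <= n)%N -> fg_free (G i)) :
  exists (SF : rmodType R)
         (alpha : {linear F n.+2 -> SF}) (beta : {linear SF -> G n}),
    [/\ stably_free SF,
        exact_seq m (C := splice alpha beta) epsG
      & chain_homotopy_equivalent (splice alpha beta) F].
Proof.
have [F0 surjF Fe Fex] := exF; have [G0 surjG Ge Gex] := exG.
have resF : resolves m epsF by split.
have resG : resolves n epsG by split.
have [|||||S [alpha [beta [sfS resS equivS]]]] :=
  @splice_exchange R n m M (F 0%N) F G (bd F 0) epsF epsG hnm _ resG.
- exact: (proj1 (resolves_cons m epsF) resF).
- by move=> a; split=> _; [apply: surjG | apply: surjF].
- exact/fg_free_stably_free/freeF.
- by move=> i /andP[_]; apply: freeF.
- exact: freeG.
exists S, alpha, beta; split=> //; first by have [? ? ?] := resS; split.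
split; [exact: resolves_complex resS | exact: resolves_complex resF |].
have [f [g [[fC _] [gC _] gf fg]]] :=
  aug_equiv_trans equivS (aug_equiv_sym (aug_equiv_seq_cons epsF)).
by exists f, g.
Qed.
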